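(* The function $\|\cdot\|_\ominus:\mathbb{D}_\ominus\to[0,+\infty)$, $\|\mathbf{x}\|_\ominus=\sqrt{\mathcal{A}(\mathbf{x})-\mathcal{B}(\mathbf{x})}$, is a norm (on the real vector space $\mathbb{D}_\ominus$).
   Context: Elements of $\mathbb{R}^4$ are written $\mathbf{x}=(X_{\mathbf{1}},X_{\mathbf{i}},X_{\mathbf{j}},X_{\mathbf{k}})$, with the standard real vector space structure. Put $\mathcal{A}(\mathbf{x})=X_{\mathbf{1}}^2+X_{\mathbf{i}}^2+X_{\mathbf{j}}^2+X_{\mathbf{k}}^2$ and $\mathcal{B}(\mathbf{x})=\sqrt2\,(X_{\mathbf{1}}X_{\mathbf{i}}+X_{\mathbf{i}}X_{\mathbf{j}}+X_{\mathbf{j}}X_{\mathbf{k}}-X_{\mathbf{k}}X_{\mathbf{1}})$, and define $\mathbb{D}_\ominus=\{\mathbf{x}\in\mathbb{R}^4:\mathcal{A}(\mathbf{x})+\mathcal{B}(\mathbf{x})=0\}$, which is a linear subspace of $\mathbb{R}^4$. *)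

(* Defs.v *)
From HB Require Import structures.
From mathcomp Require Import all_boot all_order all_algebra.
From mathcomp Require Import reals.
From mathcomp Require Import ring lra.

Set Implicit Arguments.
Unset Strict Implicit.
Unset Printing Implicit Defensive.

Import Order.TTheory GRing.Theory Num.Theory.
Local Open Scope ring_scope.

(* The coordinates X_1, X_i, X_j, X_k of x : 'rV[R]_4 are x 0 0, x 0 1, x 0 2
   and x 0 3. *)

Definition quadA (R : realType) (x : 'rV[R]_4) : R :=
  x 0 0 ^+ 2 + x 0 1 ^+ 2 + x 0 2 ^+ 2 + x 0 3 ^+ 2.

Definition quadB (R : realType) (x : 'rV[R]_4) : R :=
  Num.sqrt 2 * (x 0 0 * x 0 1 + x 0 1 * x 0 2 + x 0 2 * x 0 3 - x 0 3 * x 0 0).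

Definition Dominus_pred (R : realType) : {pred 'rV[R]_4} :=
  [pred x | quadA x + quadB x == 0].
Arguments Dominus_pred : clear implicits.

(* quadA + quadB is a sum of two squares of linear forms, so its zero set is
   the common kernel of these forms. *)
Lemma Dominus_predE (R : realType) (x : 'rV[R]_4) :
  (x \in Dominus_pred R) =
  (Num.sqrt 2 * x 0 1 + (x 0 0 + x 0 2) == 0) &&
  (Num.sqrt 2 * x 0 3 + (x 0 2 - x 0 0) == 0).
Proof.
rewrite inE /quadA /quadB.
have s2 : Num.sqrt 2 ^+ 2 = 2 :> R by rewrite sqr_sqrtr ?ler0n.
set s := Num.sqrt 2 in s2 *.
rewrite -[X in X && _]sqrf_eq0 -[X in _ && X]sqrf_eq0 -paddr_eq0 ?sqr_ge0 //.
rewrite -[LHS](mulrI_eq0 _ (mulfI (_ : 2 != 0 :> R))) ?pnatr_eq0 //.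
by congr (_ == 0); ring: s2.
Qed.

Lemma Dominus_submod_closed (R : realType) : submod_closed (Dominus_pred R).
Proof.
split=> [|a x y]; first by rewrite Dominus_predE !mxE !(mulr0, addr0, subr0) eqxx.
rewrite !Dominus_predE => /andP[/eqP x1 /eqP x2] /andP[/eqP y1 /eqP y2].
rewrite !mxE; apply/andP; split; apply/eqP.
  transitivity (a * (Num.sqrt 2 * x 0 1 + (x 0 0 + x 0 2)) +
                (Num.sqrt 2 * y 0 1 + (y 0 0 + y 0 2))); first by ring.
  by rewrite x1 y1 mulr0 addr0.
transitivity (a * (Num.sqrt 2 * x 0 3 + (x 0 2 - x 0 0)) +
              (Num.sqrt 2 * y 0 3 + (y 0 2 - y 0 0))); first by ring.
by rewrite x2 y2 mulr0 addr0.
Qed.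

HB.instance Definition _ (R : realType) :=
  GRing.isSubmodClosed.Build R 'rV[R]_4 (Dominus_pred R)
    (Dominus_submod_closed R).

Record Dominus (R : realType) := MkDominus {
  Dominus_val :> 'rV[R]_4;
  _ : Dominus_val \in Dominus_pred R
}.

HB.instance Definition _ (R : realType) := [isSub for @Dominus_val R].
HB.instance Definition _ (R : realType) := [Choice of Dominus R by <:].
HB.instance Definition _ (R : realType) :=
  [SubChoice_isSubLmodule of Dominus R by <:].

Definition normOminus (R : realType) (x : Dominus R) : R :=
  Num.sqrt (quadA x - quadB x).

Record is_norm (R : realType) (V : lmodType R) (N : V -> R) : Prop := IsNorm {
  is_norm_ge0 : forall x, 0 <= N x;
  is_norm_eq0 : forall x, N x = 0 <-> x = 0;
  is_normZ : forall a x, N (a *: x) = `|a| * N x;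
  is_normD : forall x y, N (x + y) <= N x + N y
}.

(* Main.v *)
Require Import Defs.
From mathcomp Require Import all_boot all_order all_algebra.
From mathcomp Require Import reals.
From mathcomp Require Import ring lra.
Import Order.TTheory GRing.Theory Num.Theory.
Local Open Scope ring_scope.

(** On the subspace, [quadB = - quadA], hence [quadA - quadB = 2 * quadA] and
    the function is [sqrt 2] times the Euclidean norm of R^4. *)

(** A positive multiple of the Euclidean norm, restricted to a linear subspace, is a norm;
    [normOminusE] puts the function in this form. Definiteness comes from [quadA_eq0], homogeneity
    from [quadAZ], and the triangle inequality from [sqrt_quadAD], which rests on Cauchy-Schwarz. *)

Definition dotA {R : realType} (x y : 'rV[R]_4) : R :=
  x 0 0 * y 0 0 + x 0 1 * y 0 1 + x 0 2 * y 0 2 + x 0 3 * y 0 3.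

Lemma quadA_ge0 {R : realType} (x : 'rV[R]_4) : 0 <= quadA x.
Proof. by rewrite !addr_ge0 ?sqr_ge0. Qed.

Lemma quadA_eq0 {R : realType} (x : 'rV[R]_4) : quadA x = 0 -> x = 0.
Proof.
move=> /eqP; rewrite /quadA !paddr_eq0 ?addr_ge0 ?sqr_ge0 // !sqrf_eq0.
move=> /andP[/andP[/andP[/eqP x0 /eqP x1] /eqP x2] /eqP x3].
apply/rowP => i; rewrite mxE.
(* The ordinals produced by the case split carry their own bound proof and match the numerals only
   by value, hence [val_inj]. *)
by case: i => -[|[|[|[|//]]]] lt_i4; [rewrite -[RHS]x0|rewrite -[RHS]x1
  |rewrite -[RHS]x2|rewrite -[RHS]x3]; congr (x _ _); apply/val_inj.
Qed.

Lemma quadA0 (R : realType) : quadA (0 : 'rV[R]_4) = 0.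
Proof. by rewrite /quadA !mxE expr0n !addr0. Qed.

Lemma quadAZ {R : realType} (a : R) (x : 'rV[R]_4) :
  quadA (a *: x) = a ^+ 2 * quadA x.
Proof. by rewrite /quadA !mxE; ring. Qed.

Lemma quadAD {R : realType} (x y : 'rV[R]_4) :
  quadA (x + y) = quadA x + quadA y + 2 * dotA x y.
Proof. by rewrite /quadA /dotA !mxE; ring. Qed.

Lemma dotA_CauchySchwarz {R : realType} (x y : 'rV[R]_4) :
  dotA x y ^+ 2 <= quadA x * quadA y.
Proof.
rewrite -subr_ge0 /dotA /quadA.
(* Lagrange's identity *)
have -> : (x 0 0 ^+ 2 + x 0 1 ^+ 2 + x 0 2 ^+ 2 + x 0 3 ^+ 2) *
    (y 0 0 ^+ 2 + y 0 1 ^+ 2 + y 0 2 ^+ 2 + y 0 3 ^+ 2) -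
    (x 0 0 * y 0 0 + x 0 1 * y 0 1 + x 0 2 * y 0 2 + x 0 3 * y 0 3) ^+ 2 =
    (x 0 0 * y 0 1 - x 0 1 * y 0 0) ^+ 2 + (x 0 0 * y 0 2 - x 0 2 * y 0 0) ^+ 2 +
    (x 0 0 * y 0 3 - x 0 3 * y 0 0) ^+ 2 + (x 0 1 * y 0 2 - x 0 2 * y 0 1) ^+ 2 +
    (x 0 1 * y 0 3 - x 0 3 * y 0 1) ^+ 2 + (x 0 2 * y 0 3 - x 0 3 * y 0 2) ^+ 2.
  by ring.
by rewrite !addr_ge0 ?sqr_ge0.
Qed.

Lemma sqrt_quadAD {R : realType} (x y : 'rV[R]_4) :
  Num.sqrt (quadA (x + y)) <= Num.sqrt (quadA x) + Num.sqrt (quadA y).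
Proof.
have dot_le : dotA x y <= Num.sqrt (quadA x) * Num.sqrt (quadA y).
  rewrite -sqrtrM ?quadA_ge0 // (le_trans (ler_norm _)) // -sqrtr_sqr.
  by rewrite ler_wsqrtr ?dotA_CauchySchwarz.
(* Both sides are nonnegative, so their squares may be compared; these differ only in the cross
   term, bounded by [dot_le]. *)
rewrite -ler_sqr ?nnegrE ?addr_ge0 ?sqrtr_ge0 // sqrrD !sqr_sqrtr ?quadA_ge0 //.
by rewrite quadAD; lra.
Qed.

Lemma Dominus_quadAB {R : realType} (x : Dominus R) :
  quadA x - quadB x = 2 * quadA x.
Proof. by have := valP x; rewrite inE => /eqP /= AB0; lra. Qed.

Lemma normOminusE {R : realType} (x : Dominus R) :
  normOminus x = Num.sqrt 2 * Num.sqrt (quadA x).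
Proof. by rewrite /normOminus Dominus_quadAB sqrtrM ?ler0n. Qed.

Theorem theorem11 (R : realType) :
  (forall x : Dominus R, 0 <= quadA x - quadB x) /\
  is_norm (@normOminus R).
Proof.
have sqrt2_gt0 : 0 < Num.sqrt 2 :> R by rewrite sqrtr_gt0 ltr0n.
split=> [x|]; first by rewrite Dominus_quadAB mulr_ge0 ?quadA_ge0.
split=> [x|x|a x|x y].
- exact: sqrtr_ge0.
- rewrite normOminusE; split=> [/eqP|->]; last first.
    by rewrite (_ : quadA _ = 0) ?sqrtr0 ?mulr0 // quadA0.
  (* [Num.sqrt] vanishes on all nonpositive numbers, so only [quadA x <= 0] is obtained here;
     [quadA_ge0] turns it into an equality. *)
  rewrite mulf_eq0 gt_eqF //= sqrtr_eq0 => A_le0; apply/val_inj/quadA_eq0.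
  by apply/le_anti; rewrite A_le0 quadA_ge0.
(* The operations of [Dominus] are, up to conversion, those of the ambient space, so the lemmas on
   row vectors apply here and to the sum below. *)
- by rewrite !normOminusE [quadA _]quadAZ sqrtrM ?sqr_ge0 // sqrtr_sqr mulrCA.
- by rewrite !normOminusE -mulrDr ler_pM2l //; exact: sqrt_quadAD.
Qed.
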